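(* Let $X$, $Y$, $\mathcal{S}$, $\mathcal{R}$, $\phi$ satisfy conditions (C1)–(C6) listed in the context, with $p$ the exponent in (C5). Let $y\in Y$ and assume that $y$ has an $\mathcal{S}$-solution. Let $y_k\in Y$ with $\mathcal{D}(y_k,y)\le\delta_k$ and $\delta_k\to0$. Choose $\alpha=\alpha(\delta)>0$ such that $\alpha_k:=\alpha(\delta_k)$ satisfies $\lim_k\alpha_k=\lim_k\delta_k^p/\alpha_k=0$. Assume that $x_k\in X$ and $z_k\in X^*$ are such that $$z_k\in\partial_{\alpha_k\phi}\big(\mathcal{S}(\cdot,y_k)+\alpha_k\mathcal{R}(\cdot)\big)(x_k),\qquad \frac{\|z_k\|}{\alpha_k}\to0,\qquad\langle z_k,x_k\rangle\le0.$$ Denote by $(x_k)_k$ also a weakly convergent subsequence, with weak limit $x_+$, and suppose that along it $z_k=s_k+\alpha_kr_k$ with $s_k\in\partial_0\mathcal{S}(\cdot,y_k)(x_k)$ and $r_k\in\partial_\phi\mathcal{R}(x_k)$. Then any cluster point $r$ (in the norm topology of $X^*$) of the sequence $(r_k)_k$ satisfies $$-r\in-\partial_\phi\mathcal{R}(x_+)\cap N_{L(y)}(x_+),$$ where $L(y)=\{u\in X:\mathcal{S}(u,y)=0\}$ is the convex set of all $\mathcal{S}$-solutions of $y$ and $N_{L(y)}(x_+)$ is its normal cone at $x_+$.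
   Context: An element $z\in X$ is called an $\mathcal{S}$-solution of $y\in Y$ if $\mathcal{S}(z,y)=0$. The normal cone of a convex set $L\subseteq X$ at $x\in L$ is $N_L(x)=\{q\in X^*:\langle q,u-x\rangle\le0\text{ for all }u\in L\}$. Relative subgradients: for a Banach space $X$ with dual $X^*$, $F\colon X\to\mathbb{R}$ and $\psi\colon X\to[0,\infty)$, the set $\partial_\psi F(x)$ consists of all $r\in X^*$ with $F(x)+\langle r,u-x\rangle\le F(u)+\psi(u)$ for all $u\in X$; $\partial_0F(x)$ is the usual subdifferential. $F$ is relatively sub-differentiable with bound $\psi$ if $\partial_\psi F(x)\ne\emptyset$ for all $x\in X$. Setting: $\mathcal{S}\colon X\times Y\to[0,\infty)$, $\mathcal{R}\colon X\to[0,\infty)$, $\phi\colon X\to[0,\infty)$, $\mathcal{T}_{\alpha,y}(x)=\mathcal{S}(x,y)+\alpha\mathcal{R}(x)$ and: (C1) $X$ is a reflexive Banach space and $Y$ is a metric space with metric $\mathcal{D}$. (C2) $\mathcal{R}$ is weakly sequentially lower semi-continuous. (C3) $\mathcal{R}$ is relatively sub-differentiable with bound $\phi$. (C4) $\mathcal{S}$ is weakly sequentially lower semi-continuous (i.e. $x_k\rightharpoonup x$ weakly in $X$ and $y_k\to y$ in $Y$ imply $\mathcal{S}(x,y)\le\liminf_k\mathcal{S}(x_k,y_k)$), convex in its first argument and continuous in its second argument. (C5) There exist $C>0$ and $p\ge1$ such that $\mathcal{S}(z,y)\le C\big(\mathcal{S}(z,y')+\mathcal{D}(y,y')^p\big)$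 for all $z\in X$ and $y,y'\in Y$. (C6) For all $\alpha>0$ and $y\in Y$ the functional $\mathcal{T}_{\alpha,y}$ is coercive, i.e. $\mathcal{T}_{\alpha,y}(x)\to\infty$ as $\|x\|\to\infty$. *)

(* Defs.v *)
From HB Require Import structures.
From mathcomp Require Import all_boot all_order all_algebra.
From mathcomp Require Import all_classical all_reals all_analysis.

Set Implicit Arguments.
Unset Strict Implicit.
Unset Printing Implicit Defensive.

Import Order.TTheory GRing.Theory Num.Theory.
Import numFieldNormedType.Exports.

Local Open Scope classical_set_scope.
Local Open Scope ring_scope.

(* The topological dual of X: the type of continuous linear functionals,
   a normed module over R for the operator norm. Consequently [cluster] and
   [nbhs] on this type refer to the norm topology, and the bidual of X is
   [dual_space (dual_space X)]. *)
Section DualSpace.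
Context {R : realType} (X : normedModType R).

Definition dual_pred : {pred X -> R^o} :=
  fun f => `[< linear f /\ continuous f >].

Record dual_space := DualSpace {
  dual_fun :> X -> R^o ;
  dual_funP : dual_fun \in dual_pred }.

HB.instance Definition _ := [isSub for dual_fun].
HB.instance Definition _ := [Choice of dual_space by <:].

Lemma dual_linear (f : dual_space) : linear f.
Proof. by case: f => f /= /asboolP[]. Qed.

Lemma dual_continuous (f : dual_space) : continuous f.
Proof. by case: f => f /= /asboolP[]. Qed.

Fact dual_submod_closed : submod_closed dual_pred.
Proof.
split.
- apply/asboolP; split=> [a x y|]; last by move=> x; exact: cvg_cst.
  by rewrite /= scaler0 addr0.
- move=> a f g /asboolP[fl fc] /asboolP[gl gc]; apply/asboolP; split.
    move=> b u v.
    rewrite -[LHS]/(a * f (b *: u + v) + g (b *: u + v)) fl gl.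
    rewrite -[RHS]/(b * (a * f u + g u) + (a * f v + g v)).
    by rewrite -![_ *: _]/(_ * _) !mulrDr addrACA [a * (b * _)]mulrCA.
  by move=> x; apply: cvgD; [apply: cvgZr; exact: fc|exact: gc].
Qed.

HB.instance Definition _ :=
  GRing.isSubmodClosed.Build R (X -> R^o) dual_pred dual_submod_closed.
HB.instance Definition _ := [SubChoice_isSubLmodule of dual_space by <:].

Implicit Types (f g : dual_space) (x : X).

Lemma dualDE f g x : (f + g) x = f x + g x. Proof. by []. Qed.

Lemma dualNE f x : (- f) x = - f x. Proof. by []. Qed.

Lemma dualZE (a : R) f x : (a *: f) x = a * f x. Proof. by []. Qed.

HB.instance Definition _ f :=
  GRing.isLinear.Build R X R^o *:%R (dual_fun f) (dual_linear f).

Definition dual_norm f : R :=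
  sup [set `|f x| | x in [set x : X | `|x| <= 1]].

Fact dual_norm_has_sup f :
  has_sup [set `|f x| | x in [set x : X | `|x| <= 1]].
Proof.
split; first by exists `|f 0|, 0 => //=; rewrite normr0.
have fb : bounded_near f (nbhs (0 : X)).
  by apply/linear_bounded_continuous; exact: dual_continuous.
have [M fM] := (bounded_funP _).2 fb 1.
by exists M => _ [x /= x1 <-]; exact: fM.
Qed.

Fact dual_norm_ub f x : `|x| <= 1 -> `|f x| <= dual_norm f.
Proof.
by move=> x1; apply: (ub_le_sup (dual_norm_has_sup f).2); exists x.
Qed.

Fact dual_norm_le f (M : R) :
  (forall x, `|x| <= 1 -> `|f x| <= M) -> dual_norm f <= M.
Proof.
move=> fM; apply: (ge_sup (dual_norm_has_sup f).1) => _ [x /= x1 <-].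
exact: fM.
Qed.

Lemma le_dual_norm f x : `|f x| <= dual_norm f * `|x|.
Proof.
have [->|x0] := eqVneq x 0; first by rewrite linear0 !normr0 mulr0.
rewrite -ler_pdivrMr ?normr_gt0//.
suff -> : `|f x| / `|x| = `|f (`|x|^-1 *: x)|.
  by apply: dual_norm_ub; rewrite normrZ normfV normr_id mulVf ?normr_eq0.
by rewrite linearZ /GRing.scale /= normrM normfV normr_id mulrC.
Qed.

Fact dual_normD f g : dual_norm (f + g) <= dual_norm f + dual_norm g.
Proof.
apply: dual_norm_le => x x1; rewrite dualDE (le_trans (ler_normD _ _))//.
by rewrite lerD// dual_norm_ub.
Qed.

Fact dual_normZ (a : R) f : dual_norm (a *: f) = `|a| * dual_norm f.
Proof.
have le_normZ (b : R) g : dual_norm (b *: g) <= `|b| * dual_norm g.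
  apply: dual_norm_le => x x1.
  by rewrite dualZE normrM ler_wpM2l// dual_norm_ub.
apply/eqP; rewrite eq_le le_normZ /=.
have [->|a0] := eqVneq a 0.
  rewrite normr0 mul0r (le_trans _ (dual_norm_ub (0 *: f) (x := 0) _))//.
  by rewrite normr0.
rewrite -ler_pdivlMl ?normr_gt0// -normfV.
by rewrite -[in leLHS](scale1r f) -(mulVf a0) -scalerA.
Qed.

Fact dual_norm0_eq0 f : dual_norm f = 0 -> f = 0.
Proof.
move=> f0; apply/val_inj/funext => x; apply/normr0_eq0/le_anti.
by rewrite normr_ge0 andbT (le_trans (le_dual_norm f x))// f0 mul0r.
Qed.

HB.instance Definition _ := Lmodule_isNormed.Build R dual_space
  dual_normD dual_normZ dual_norm0_eq0.

Lemma dual_normE f : `|f| = dual_norm f. Proof. by []. Qed.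

End DualSpace.

Section BanachNotions.
Context {R : realType} {X : normedModType R}.
Implicit Types (F psi : X -> R) (x : X) (L : set X).

(* Surjectivity of the canonical embedding into the bidual. *)
Definition reflexive_space (V : normedModType R) : Prop :=
  forall Phi : dual_space (dual_space V),
    exists x : V, forall f : dual_space V, Phi f = f x.

Definition weak_cvg (u : nat -> X) x : Prop :=
  forall f : dual_space X, f (u k) @[k --> \oo] --> f x.

Definition weak_seq_lsc F : Prop :=
  forall (u : nat -> X) x, weak_cvg u x ->
    ((F x)%:E <= limn_einf (fun k => (F (u k))%:E))%E.

(* F x tends to +oo as the norm of x tends to +oo. *)
Definition coercive F : Prop :=
  forall M : R, \forall r \near +oo, forall x, r <= `|x| -> M <= F x.

Definition rel_subdiff psi F x : set (dual_space X) :=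
  [set r | forall u, F x + r (u - x) <= F u + psi u].

Definition rel_subdifferentiable psi F : Prop :=
  forall x, rel_subdiff psi F x !=set0.

(* Intended for convex L and x in L only; neither is enforced here. *)
Definition normal_cone L x : set (dual_space X) :=
  [set q | forall u, L u -> q (u - x) <= 0].

End BanachNotions.

Section Tikhonov.
Context {R : realType} {X : completeNormedModType R} {Y : metricType R}.
Implicit Types (calS : X -> Y -> R) (calR phi : X -> R).

Definition solutions calS (y : Y) : set X := [set z | calS z y = 0].

Definition tikhonov calS calR (alpha : R) (y : Y) : X -> R :=
  fun x => calS x y + alpha * calR x.

(* Joint lower semi-continuity: weak in X, metric in Y. *)
Definition similarity_lsc calS : Prop :=
  forall (u : nat -> X) x (v : nat -> Y) y, weak_cvg u x -> v @ \oo --> y ->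
    ((calS x y)%:E <= limn_einf (fun k => (calS (u k) (v k))%:E))%E.

Record tikhonov_conditions calS calR phi (p : R) : Prop := {
  S_ge0 : forall x y, 0 <= calS x y ;
  R_ge0 : forall x, 0 <= calR x ;
  phi_ge0 : forall x, 0 <= phi x ;
  X_reflexive : reflexive_space X ;
  R_wlsc : weak_seq_lsc calR ;
  R_subdiff : rel_subdifferentiable phi calR ;
  S_wlsc : similarity_lsc calS ;
  S_convex : forall y, convex_function [set: convex_lmodType X] (calS^~ y) ;
  S_continuous : forall x, continuous (calS x : Y -> R) ;
  p_ge1 : 1 <= p ;
  S_quasi_triangle : exists2 C : R, 0 < C &
    forall z y y', calS z y <= C * (calS z y' + mdist y y' `^ p) ;
  T_coercive : forall alpha y, 0 < alpha -> coercive (tikhonov calS calR alpha y)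
}.

End Tikhonov.

(* Main.v *)
Require Import Defs.
From HB Require Import structures.
From mathcomp Require Import all_boot all_order all_algebra.
From mathcomp Require Import all_classical all_reals all_analysis.
From mathcomp Require Import ring lra.

Set Implicit Arguments.
Unset Strict Implicit.
Unset Printing Implicit Defensive.

Import Order.TTheory GRing.Theory Num.Theory.
Import numFieldNormedType.Exports.

Local Open Scope classical_set_scope.
Local Open Scope ring_scope.

(* Testing the subgradient inequality for [z k] at an [S]-solution [u0] and
   using [z k (x k) <= 0] gives [S(x_k, y_k) + alpha_k R(x_k) <= alpha_k B_k]
   with [B_k] convergent: hence [S(x_k, y_k) --> 0], so [xp] is a solution,
   and [x_k] is bounded by coercivity of the functional with parameter 1 and
   datum [y]. Boundedness lets norm clusters of [r_k] pair with the weakly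
   convergent [x_k], so the subgradient inequality for [r_k] passes to the
   limit by lower semi-continuity of [R]; dividing the one for
   [s_k = z_k - alpha_k r_k] by [alpha_k] yields the normal cone condition. *)

Section Limits.
Context {R : realType}.

(** The lower limit is the supremum of the tail infima, so anything strictly below it is already
    below the infimum of some tail. *)
Lemma limn_einf_gt (u : nat -> \bar R) (a : \bar R) :
  (a < limn_einf u)%E -> \forall k \near \oo, (a < u k)%E.
Proof.
rewrite limn_einf_lim (cvg_lim _ (@cvg_einfs_sup _ u))//.
move=> /ereal_sup_gt[_ [N _ <-] aN].
exists N => // k Nk; apply: (lt_le_trans aN).
by apply: ereal_inf_lbound; exists k.
Qed.

Lemma cvg_mdist0 (Y : metricType R) (v : nat -> Y) (y : Y) :
  mdist (v k) y @[k --> \oo] --> (0 : R) -> v @ \oo --> y.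
Proof.
move=> vy; apply/(cvg_ballP v) => e e0.
by apply: filterS (cvgr_lt _ vy _ e0) => k; rewrite ballEmdist /= metric_sym.
Qed.

(** A cluster point is approached only along some indices, but an eventual bound shares an index
    with any such approach. The slack [e] lets bounds coming from lower limits be used directly. *)
Lemma cluster_le (a : nat -> R) (l M : R) : cluster (a @ \oo) l ->
  (forall e, 0 < e -> \forall k \near \oo, a k <= M + e) -> l <= M.
Proof.
move=> al aM; apply/ler_addgt0Pr => e e0.
have e20 : 0 < e / 2 by rewrite divr_gt0.
have [_ [/= [k akM <-] lk]] := al [set a k | k in [set k | a k <= M + e / 2]] _
  (filterS (fun k Hk => ex_intro2 _ _ k Hk erefl) (aM _ e20))
  (nbhsx_ballx l _ e20).
move: lk; rewrite /ball /= ltr_norml => /andP[_ lk]; move: akM lk => /=; lra.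
Qed.

End Limits.

Section DualPairing.
Context {R : realType} {X : normedModType R}.

Lemma weak_cvg_cst (u : X) : weak_cvg (fun=> u) u.
Proof. by move=> f; exact: cvg_cst. Qed.

Lemma weak_cvgB (x w : nat -> X) (xp wp : X) :
  weak_cvg x xp -> weak_cvg w wp -> weak_cvg (fun k => x k - w k) (xp - wp).
Proof.
move=> xxp wwp f; rewrite linearB.
under eq_fun do rewrite linearB.
by apply: cvgB; [exact: xxp|exact: wwp].
Qed.

(** Split [rr xp - r k (x k)] as [rr (xp - x k)], small eventually by weak convergence, plus
    [(rr - r k) (x k)], at most [M] times a norm distance that is small at suitable indices. No
    subsequence has to be extracted. *)
Lemma cluster_pairing (r : nat -> dual_space X) (rr : dual_space X)
    (x : nat -> X) (xp : X) (M : R) :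
  weak_cvg x xp -> (\forall k \near \oo, `|x k| <= M) ->
  cluster (r @ \oo) rr -> cluster ((fun k => (r k (x k) : R)) @ \oo) (rr xp).
Proof.
move=> xxp xM r_rr A B Ar /nbhs_ballP[e /= e0 eB].
have e20 : 0 < e / 2 by rewrite divr_gt0.
(* [M] may be zero or negative; this denominator is positive and still bounds the norms of the
   [x k]. *)
pose d := e / 2 / (`|M| + 1).
have M1 : 0 < `|M| + 1 by rewrite ltr_wpDl.
have d0 : 0 < d by rewrite divr_gt0.
have xe : \forall k \near \oo, `|rr xp - rr (x k)| < e / 2.
  by move/cvgrPdist_lt: (xxp rr) => /(_ _ e20).
pose Q k := [/\ A (r k (x k) : R), `|x k| <= M & `|rr xp - rr (x k)| < e / 2].
have QF : \forall k \near \oo, Q k.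
  by near=> k; split; near: k.
have [_ [/= [k [Ak xkM rrk] <-] rk]] := r_rr [set r k | k in Q] _
  (filterS (fun k Hk => ex_intro2 _ _ k Hk erefl) QF) (nbhsx_ballx rr _ d0).
exists (r k (x k)); split=> //; apply: eB.
move: rk; rewrite -ball_normE /= => rk.
rewrite /ball /=.
have -> : rr xp - r k (x k) = (rr xp - rr (x k)) + (rr - r k) (x k).
  by rewrite dualDE dualNE addrA subrK.
rewrite (le_lt_trans (ler_normD _ _))// [e]splitr ltr_leD//.
rewrite (le_trans (le_dual_norm _ _))// -dual_normE.
rewrite -[e / 2](@divfK _ (`|M| + 1)) ?gt_eqF//.
apply: ler_pM => //; first exact: ltW.
by rewrite (le_trans xkM)// (le_trans (ler_norm M))// lerDl.
Unshelve. all: by end_near. Qed.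

Lemma coercive_bounded (F : X -> R) (B : R) :
  coercive F -> exists M : R, forall x, F x <= B -> `|x| <= M.
Proof.
move=> /(_ (B + 1)) [M [_ MF]].
(* Coercivity at level [B + 1] contradicts [F x <= B]; it holds only for radii strictly above the
   threshold, hence the shift by 1. *)
exists (M + 1) => x FB; rewrite leNgt; apply/negP => Mx.
have := MF (M + 1) _ x (ltW Mx); rewrite ltrDl ltr01 => /(_ isT).
by move=> /le_trans /(_ FB); rewrite leNgt ltrDl ltr01.
Qed.

End DualPairing.

(** At a convex combination of zeros, convexity bounds the nonnegative function above by 0. *)
Lemma solutions_convex (R : realType) (X : completeNormedModType R)
    (Y : metricType R) (calS : X -> Y -> R) (y : Y) :
  (forall x, 0 <= calS x y) ->
  convex_function [set: convex_lmodType X] (calS^~ y) ->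
  convex_set (solutions calS y : set (convex_lmodType X)).
Proof.
move=> S0 Scvx u v l /set_mem uL /set_mem vL; apply/mem_set.
have := Scvx l u v; rewrite !inE => /(_ I I).
rewrite uL vL convRE !mulr0 addr0 => Sle.
by apply/le_anti; rewrite Sle S0.
Qed.

Theorem theorem3p6 (R : realType) (X : completeNormedModType R)
    (Y : metricType R) (calS : X -> Y -> R) (calR phi : X -> R) (p : R)
    (HC : tikhonov_conditions calS calR phi p)
    (y : Y) (y_solvable : solutions calS y !=set0)
    (yk : nat -> Y) (delta : nat -> R)
    (y_delta : forall k, mdist (yk k) y <= delta k)
    (delta_cvg0 : delta k @[k --> \oo] --> (0 : R))
    (alpha : R -> R)
    (alpha_gt0 : forall k, 0 < alpha (delta k))
    (alpha_cvg0 : alpha (delta k) @[k --> \oo] --> (0 : R))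
    (delta_alpha_cvg0 :
      delta k `^ p / alpha (delta k) @[k --> \oo] --> (0 : R))
    (x : nat -> X) (z : nat -> dual_space X)
    (z_subgrad : forall k,
      rel_subdiff (fun u => alpha (delta k) * phi u)
        (tikhonov calS calR (alpha (delta k)) (yk k)) (x k) (z k))
    (z_cvg0 : `|z k| / alpha (delta k) @[k --> \oo] --> (0 : R))
    (z_le0 : forall k, z k (x k) <= 0)
    (n : nat -> nat) (n_incr : {homo n : i j / (i < j)%N})
    (xp : X) (x_weak : weak_cvg (x \o n) xp)
    (s r : nat -> dual_space X)
    (z_decomp : forall k, z (n k) = s k + alpha (delta (n k)) *: r k)
    (s_subgrad : forall k,
      rel_subdiff (fun=> 0) (calS^~ (yk (n k))) (x (n k)) (s k))
    (r_subgrad : forall k, rel_subdiff phi calR (x (n k)) (r k)) :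
  [/\ convex_set (solutions calS y : set (convex_lmodType X)),
      solutions calS y xp &
      forall rr : dual_space X, cluster (r @ \oo) rr ->
        ([set - q | q in rel_subdiff phi calR xp]
           `&` normal_cone (solutions calS y) xp) (- rr)].
Proof.
have n_oo : n @ \oo --> \oo.
  apply/cvgnyPge => N; exists N => // k /= Nk; rewrite (leq_trans Nk)//.
  (* A strictly increasing [n] satisfies [k <= n k]. *)
  elim: {Nk}k => // k IHk; exact: (leq_ltn_trans IHk (n_incr _ _ (ltnSn k))).
have [u0 u0L] := y_solvable.
have [C C0 SC] := S_quasi_triangle HC.
pose a k := alpha (delta k).
have a0 k : 0 < a k by exact: alpha_gt0.
have delta_ge0 k : 0 <= delta k by exact: le_trans (mdist_ge0 _ _) (y_delta k).
have mdist_powR k : mdist (yk k) y `^ p <= delta k `^ p.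
  by rewrite ge0_ler_powR ?nnegrE ?mdist_ge0// (le_trans ler01)// (p_ge1 HC).
have S_sol u k : solutions calS y u -> calS u (yk k) <= C * delta k `^ p.
  move=> uL; rewrite (le_trans (SC u (yk k) y))// uL add0r.
  by rewrite ler_wpM2l// ltW.
have dualN_le (f : dual_space X) (u : X) : - f u <= `|f| * `|u|.
  by rewrite (le_trans (ler_norm _))// normrN le_dual_norm.
pose B k := C * (delta k `^ p / a k) + (calR u0 + phi u0)
  + `|z k| / a k * `|u0|.
have SRB k : calS (x k) (yk k) + a k * calR (x k) <= a k * B k.
  have -> : a k * B k = C * delta k `^ p + a k * (calR u0 + phi u0)
      + `|z k| * `|u0|.
    by rewrite /B; field; exact: lt0r_neq0.
  (* Since [z k (x k) <= 0], the term [z k (u0 - x k)] is at least [z k u0], hence at least minus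
     the product of the norms of [z k] and [u0]. *)
  have := z_subgrad k u0; rewrite /tikhonov linearB /= -/(a k).
  have := S_sol u0 k u0L; have := dualN_le (z k) u0; have := z_le0 k.
  lra.
have B_cvg : B k @[k --> \oo] --> calR u0 + phi u0.
  have -> : calR u0 + phi u0 = C * 0 + (calR u0 + phi u0) + 0 * `|u0| by ring.
  apply: cvgD; last by apply: cvgMr_tmp; exact: z_cvg0.
  by apply: cvgD; [apply: cvgMl_tmp; exact: delta_alpha_cvg0|exact: cvg_cst].
have S_le k : calS (x k) (yk k) <= a k * B k.
  by apply: le_trans (SRB k); rewrite lerDl mulr_ge0 ?(R_ge0 HC)// ltW.
have R_le k : calR (x k) <= B k.
  rewrite -(ler_pM2l (a0 k)); apply: le_trans (SRB k).
  by rewrite lerDr (S_ge0 HC).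
have S_cvg : calS (x k) (yk k) @[k --> \oo] --> (0 : R).
  apply: (@squeeze_cvgr _ _ _ _ (cst 0) (fun k => a k * B k)).
  - by apply: nearW => k; rewrite (S_ge0 HC) S_le.
  - exact: cvg_cst.
  - rewrite -[X in _ --> X](mul0r (calR u0 + phi u0)).
    by apply: cvgM; [exact: alpha_cvg0|exact: B_cvg].
have dp_cvg : delta k `^ p @[k --> \oo] --> (0 : R).
  rewrite -(mul0r (0 : R)).
  under eq_fun => k do rewrite -[delta k `^ p](divfK (lt0r_neq0 (a0 k))).
  by apply: cvgM; [exact: delta_alpha_cvg0|exact: alpha_cvg0].
have y_cvg : yk @ \oo --> y.
  apply: cvg_mdist0; apply: (@squeeze_cvgr _ _ _ _ (cst 0) delta).
  - by apply: nearW => k; rewrite mdist_ge0 y_delta.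
  - exact: cvg_cst.
  - exact: delta_cvg0.
have [M xM] : exists M, \forall k \near \oo, `|x k| <= M.
  pose b := calR u0 + phi u0 + 1.
  (* The quasi-triangle inequality trades the datum [yk k] for [y]. The two 1s bound
     [calS (x k) (yk k)] and [delta k] to the power [p] eventually, and [b] bounds [B k] and thus
     [calR (x k)]. *)
  have [M MT] := coercive_bounded (C * (1 + 1) + b) (T_coercive HC y ltr01).
  exists M.
  have S1 : \forall k \near \oo, calS (x k) (yk k) <= 1.
    exact: cvgr_le _ S_cvg _ ltr01.
  have d1 : \forall k \near \oo, delta k `^ p <= 1.
    exact: cvgr_le _ dp_cvg _ ltr01.
  have B1 : \forall k \near \oo, B k <= b.
    by apply: cvgr_le _ B_cvg _ _; rewrite ltrDl.
  near=> k; apply: MT; rewrite /tikhonov mul1r lerD//; last first.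
    by rewrite (le_trans (R_le k))//; near: k.
  rewrite (le_trans (SC _ y (yk k)))// ler_wpM2l ?(ltW C0)// lerD//.
    by near: k.
  by rewrite metric_sym (le_trans (mdist_powR k))//; near: k.
have xnM u : \forall k \near \oo, `|x (n k) - u| <= M + `|u|.
  have : \forall k \near \oo, `|x (n k)| <= M by exact: n_oo _ xM.
  apply: filterS => k /= xkM.
  by rewrite (le_trans (ler_normB _ _))// lerD2r.
have xp_sol : solutions calS y xp.
  apply/le_anti; rewrite (S_ge0 HC) andbT -lee_fin.
  rewrite (le_trans (S_wlsc HC x_weak (cvg_comp _ _ n_oo y_cvg)))//.
  rewrite (cvg_limn_einf_sup (l := 0%E) _).1//.
  by apply: cvg_EFin; [exact: nearW|exact: (cvg_comp _ _ n_oo S_cvg)].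
split=> //.
  by apply: solutions_convex;
    [move=> ?; exact: (S_ge0 HC)|exact: (S_convex HC)].
move=> rr r_rr; split.
  exists rr => // u; rewrite addrC -lerBrDr.
  have uxM : \forall k \near \oo, `|u - x (n k)| <= M + `|u|.
    by apply: filterS (xnM u) => k; rewrite distrC.
  have uxp := weak_cvgB (@weak_cvg_cst _ _ u) x_weak.
  apply: (cluster_le (cluster_pairing uxp uxM r_rr)) => e e0.
  have : ((calR xp - e)%:E < limn_einf (fun k => (calR (x (n k)))%:E))%E.
    by apply: lt_le_trans (R_wlsc HC x_weak); rewrite lte_fin ltrBlDr ltrDl.
  move=> /limn_einf_gt; apply: filterS => k; rewrite lte_fin /= => Rk.
  have := r_subgrad k u; lra.
(* The sign is moved inside, so that the claim reads [rr (xp - u) <= 0]. *)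
move=> u uL; rewrite dualNE -raddfN opprB.
apply: (cluster_le (cluster_pairing
  (weak_cvgB x_weak (@weak_cvg_cst _ _ u)) (xnM u) r_rr)) => e e0.
have E_cvg : C * (delta k `^ p / a k) + `|z k| / a k * `|u| @[k --> \oo]
    --> (0 : R).
  have -> : 0 = C * 0 + 0 * `|u| by ring.
  by apply: cvgD;
    [apply: cvgMl_tmp; exact: delta_alpha_cvg0
    |apply: cvgMr_tmp; exact: z_cvg0].
have : \forall k \near \oo, C * (delta (n k) `^ p / a (n k))
    + `|z (n k)| / a (n k) * `|u| <= e.
  exact: n_oo _ (cvgr_le _ E_cvg _ e0).
apply: filterS => k Ek.
rewrite add0r; apply: le_trans Ek; rewrite -(ler_pM2l (a0 (n k))).
have -> : a (n k) * (C * (delta (n k) `^ p / a (n k))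
    + `|z (n k)| / a (n k) * `|u|) = C * delta (n k) `^ p + `|z (n k)| * `|u|.
  by field; exact: lt0r_neq0.
have zE : z (n k) (x (n k) - u)
    = s k (x (n k) - u) + a (n k) * r k (x (n k) - u).
  by rewrite z_decomp dualDE dualZE.
(* As [calS] is nonnegative, this gives [- s k (x (n k) - u) <= calS u (yk (n k))], which the
   quasi-triangle inequality bounds because [u] is a solution; the [z] term is estimated as for
   [u0]. *)
have := s_subgrad k u; rewrite -opprB linearN /= addr0.
have := S_sol u (n k) uL; have := dualN_le (z (n k)) u; have := z_le0 (n k).
have := S_ge0 HC (x (n k)) (yk (n k)); move: zE; rewrite [z (n k) _]linearB.
lra.
Unshelve. all: by end_near. Qed.
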